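(* Let $N\ge 2$, $k=\frac{N(N-1)}{2}$, and consider an $N$-Higgs-doublet potential written in bilinear form $$V=M_0K_0+M_aK_a+\Lambda_0K_0^2+L_aK_0K_a+\Lambda_{ab}K_aK_b$$ (summation over $a,b=1,\dots,N^2-1$), with $M_0,\Lambda_0\in\mathbb{R}$, $L,M\in\mathbb{R}^{N^2-1}$ and $\Lambda$ a real symmetric $(N^2-1)\times(N^2-1)$ matrix. Then $V$ admits a $CP2$ symmetry if and only if the following two conditions both hold: (i) there exist $k$ linearly independent eigenvectors $v_1,\dots,v_k\in\mathbb{R}^{N^2-1}$ of $\Lambda$ such that, writing $V_a=\sum_{i=1}^{N^2-1}(v_a)_i\lambda_i$, the real linear span $\mathcal{W}=\mathrm{span}_{\mathbb{R}}\{V_1,\dots,V_k\}$ forms a basis of (a Hermitian-matrix realization of) the defining representation of $\mathfrak{so}(N)$, i.e. $\mathcal{W}$ is closed under $(A,B)\mapsto -i[A,B]$ and there exists an invertible $S\in GL(N,\mathbb{C})$ with $S\,\mathcal{W}\,S^{-1}=\mathrm{span}_{\mathbb{R}}\{\lambda_1,\dots,\lambda_k\}=\{iA: A \text{ a real antisymmetric } N\times N \text{ matrix}\}$; (ii) $L\cdot v_a=M\cdot v_a=0$ for all $a\in\{1,\dots,k\}$.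
   Context: The model has $N$ Higgs $\mathsf{SU}(2)$ doublets $\Phi_1,\dots,\Phi_N$. The bilinears are $K_0=\Phi_i^\dagger\Phi_i$ and $K_a=\Phi_i^\dagger(\lambda_a)_{ij}\Phi_j$, $a=1,\dots,N^2-1$, where $\lambda_a$ are the generalized Gell-Mann matrices: Hermitian traceless $N\times N$ matrices with $\mathrm{Tr}(\lambda_a\lambda_b)=2\delta_{ab}$, $[\lambda_a,\lambda_b]=2if_{abc}\lambda_c$, ordered so that $\lambda_1,\dots,\lambda_k$ are the antisymmetric (purely imaginary) ones and $\lambda_{k+1},\dots,\lambda_{N^2-1}$ are the symmetric (real) ones. A change of doublet basis $\Phi_i\to U_{ij}\Phi_j$, $U\in\mathsf{SU}(N)$, leaves $K_0$ invariant and sends $K_a\to R_{ab}(U)K_b$ with $R_{ab}(U)=\frac12\mathrm{Tr}(U^\dagger\lambda_aU\lambda_b)$; correspondingly $L\to R(U)L$, $M\to R(U)M$, $\Lambda\to R(U)\Lambda R(U)^T$. A general $CP$ transformation is $\Phi_i(\vec x,t)\to V_{ij}\Phi_j^*(-\vec x,t)$ with $V\in\mathsf{U}(N)$; the potential admits a $CP2$ symmetry if it is invariant under such a transformation which is of order 2 (applying it twice gives the identity). It is known that a $CP2$ symmetry exists if and only if there is a doublet basis in which all coefficients of the potential are real, i.e. a basis in which $\Lambda_{ab}=0$ whenever $a\le k<b$ (so $\Lambda$ is block diagonal with respect to antisymmetric/symmetric generators) and $L_a=M_a=0$ for all $a\le k$. *)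

(* Defs.v *)
From HB Require Import structures.
From mathcomp Require Import all_boot all_order all_algebra.
From mathcomp Require Import reals.
From mathcomp Require Export complex.
Set Implicit Arguments. Unset Strict Implicit. Unset Printing Implicit Defensive.
Import Order.TTheory GRing.Theory Num.Theory.
Local Open Scope ring_scope.

Section NHDM.
Variable R : realType.
Local Notation C := (R[i]).

Definition rC (x : R) : C := Complex x 0.
Definition cI : C := Complex 0 1.
Definition cconj (z : C) : C := conjc z.

Definition adjmx (m n : nat) (A : 'M[C]_(m, n)) : 'M[C]_(n, m) := (map_mx cconj A)^T.

Definition nk (N : nat) : nat := (N * (N - 1)) %/ 2.
Definition ng (N : nat) : nat := (N ^ 2 - 1)%N.

Definition gell_mann_basis (N : nat) (lam : 'I_(ng N) -> 'M[C]_N) : Prop :=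
  [/\ forall a, adjmx (lam a) = lam a,
      forall a, \tr (lam a) = 0,
      forall a b, \tr (lam a *m lam b) = (a == b)%:R *+ 2,
      forall a : 'I_(ng N), (a < nk N)%N -> map_mx cconj (lam a) = - lam a
    & forall a : 'I_(ng N), (nk N <= a)%N -> map_mx cconj (lam a) = lam a].

(* Fields: Phi : 'M_(N,2), row i = the SU(2) doublet Phi_i. *)
Definition K0 (N : nat) (Phi : 'M[C]_(N, 2)) : C :=
  \sum_(i < N) \sum_(al < 2) cconj (Phi i al) * Phi i al.

Definition Kbil (N : nat) (lama : 'M[C]_N) (Phi : 'M[C]_(N, 2)) : C :=
  \sum_(i < N) \sum_(j < N) \sum_(al < 2) cconj (Phi i al) * lama i j * Phi j al.

Definition potential (N : nat) (lam : 'I_(ng N) -> 'M[C]_N)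
    (M0 Lam0 : R) (M L : 'I_(ng N) -> R) (Lam : 'M[R]_(ng N))
    (Phi : 'M[C]_(N, 2)) : C :=
  rC M0 * K0 Phi
  + \sum_a rC (M a) * Kbil (lam a) Phi
  + rC Lam0 * K0 Phi ^+ 2
  + \sum_a rC (L a) * K0 Phi * Kbil (lam a) Phi
  + \sum_a \sum_b rC (Lam a b) * Kbil (lam a) Phi * Kbil (lam b) Phi.

(* General CP transformation Phi_i -> V_ij Phi_j^*, V unitary; it is of order 2
   iff V V^* = 1. CP2 symmetry: invariance of the potential under such a map. *)
Definition has_CP2 (N : nat) (lam : 'I_(ng N) -> 'M[C]_N)
    (M0 Lam0 : R) (M L : 'I_(ng N) -> R) (Lam : 'M[R]_(ng N)) : Prop :=
  exists U : 'M[C]_N,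
    [/\ U *m adjmx U = 1%:M,
        U *m map_mx cconj U = 1%:M
      & forall Phi : 'M[C]_(N, 2),
          potential lam M0 Lam0 M L Lam (U *m map_mx cconj Phi)
          = potential lam M0 Lam0 M L Lam Phi].

Definition Vgen (N : nat) (lam : 'I_(ng N) -> 'M[C]_N) (v : 'cV[R]_(ng N)) : 'M[C]_N :=
  \sum_i rC (v i 0) *: lam i.

Definition in_W (N : nat) (lam : 'I_(ng N) -> 'M[C]_N)
    (v : 'I_(nk N) -> 'cV[R]_(ng N)) (X : 'M[C]_N) : Prop :=
  exists c : 'I_(nk N) -> R, X = \sum_a rC (c a) *: Vgen lam (v a).

Definition i_antisym (N : nat) (Y : 'M[C]_N) : Prop :=
  exists A : 'M[R]_N, A^T = - A /\ Y = cI *: map_mx rC A.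

Definition eigvec (n : nat) (Lam : 'M[R]_n) (v : 'cV[R]_n) : Prop :=
  v != 0 /\ exists mu : R, Lam *m v = mu *: v.

Definition cond_i (N : nat) (lam : 'I_(ng N) -> 'M[C]_N) (Lam : 'M[R]_(ng N))
    (v : 'I_(nk N) -> 'cV[R]_(ng N)) : Prop :=
  [/\ row_free (\matrix_(a < nk N, i < ng N) v a i 0),
      forall a, eigvec Lam (v a),
      forall A B, in_W lam v A -> in_W lam v B ->
                  in_W lam v (- cI *: (A *m B - B *m A))
    & exists S : 'M[C]_N,
        [/\ S \in unitmx,
            forall X, in_W lam v X -> i_antisym (S *m X *m invmx S)
          & forall Y, i_antisym Y ->
              exists X, in_W lam v X /\ Y = S *m X *m invmx S]].

Definition cond_ii (N : nat) (M L : 'I_(ng N) -> R)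
    (v : 'I_(nk N) -> 'cV[R]_(ng N)) : Prop :=
  forall a, \sum_i L i * v a i 0 = 0 /\ \sum_i M i * v a i 0 = 0.

End NHDM.

(* Main.v *)
Require Import Defs.
From HB Require Import structures.
From mathcomp Require Import all_boot all_order all_algebra.
From mathcomp Require Import reals complex.
From mathcomp Require Import spectral sesquilinear ring.
Set Implicit Arguments. Unset Strict Implicit. Unset Printing Implicit Defensive.
Import Order.TTheory GRing.Theory Num.Theory.
Local Open Scope ring_scope.
Local Open Scope sesquilinear_scope.

(** Under [Phi -> U Phi^*] the bilinear [K_A] becomes [K_(sigma A)] with
    [sigma A = U A^T U^*], an involution of the traceless Hermitian matrices.
    Polarization shows that a potential determines [M], [L] and [Lambda], so
    invariance means that [sigma] fixes [M] and [L] and commutes with [Lambda].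
    An order-2 [U] is symmetric and unitary, hence [U = W W^T] with [W] unitary,
    and the (-1)-eigenspace of [sigma] is [W (i so(N)) W^dagger]: [Lambda] can
    be diagonalized on it, and [M], [L] are orthogonal to it. Conversely, by
    polar decomposition the matrix [S] of condition (i) may be taken unitary,
    and then [U = W W^T] with [W = S^dagger] is the required CP2 symmetry. *)

Local Arguments cconj {R} z : simpl never.
Local Arguments rC {R} x : simpl never.
Local Arguments cI R : simpl never.

HB.instance Definition _ (R : realType) :=
  GRing.RMorphism.copy (@cconj R) (@conjc R).
HB.instance Definition _ (R : realType) :=
  GRing.RMorphism.copy (@rC R) (real_complex R).

(** * Complex matrices *)
Section ComplexMatrices.
Context (R : realType).
Local Notation C := (R[i]).
Local Notation cmx A := (map_mx (@cconj R) A).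
Implicit Types m n p : nat.

Lemma cconjK : involutive (@cconj R).
Proof. exact: conjcK. Qed.

Lemma cconj_rC (x : R) : cconj (rC x) = rC x.
Proof. by rewrite /cconj /rC /= oppr0. Qed.

Lemma rC_inj : injective (@rC R).
Proof. exact: complexI. Qed.

Lemma cconj_real (z : C) : cconj z = z -> rC (complex.Re z) = z.
Proof.
case: z => a b [] /eqP; rewrite -subr_eq0 -opprD oppr_eq0 -mulr2n.
by rewrite mulrn_eq0 /= => /eqP->.
Qed.

Lemma mulCI : cI R * cI R = -1.
Proof. exact: (sqr_i R). Qed.

Lemma cconjI : cconj (cI R) = - cI R.
Proof. by apply/eqP; rewrite eq_complex /= oppr0 !eqxx. Qed.

Lemma cmxK m n (A : 'M[C]_(m, n)) : cmx (cmx A) = A.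
Proof. by apply/matrixP=> i j; rewrite !mxE cconjK. Qed.

Lemma adjmxE m n (A : 'M[C]_(m, n)) : adjmx A = A^t*.
Proof. by apply/matrixP=> i j; rewrite !mxE. Qed.

Lemma adjmxK m n (A : 'M[C]_(m, n)) : adjmx (adjmx A) = A.
Proof. by rewrite /adjmx map_trmx trmxK cmxK. Qed.

Lemma adjmxM m n p (A : 'M[C]_(m, n)) (B : 'M[C]_(n, p)) :
  adjmx (A *m B) = adjmx B *m adjmx A.
Proof. by rewrite /adjmx map_mxM trmx_mul. Qed.

Lemma tr_adjmx m n (A : 'M[C]_(m, n)) : (adjmx A)^T = cmx A.
Proof. by rewrite trmxK. Qed.

Lemma cmx_adjmx m n (A : 'M[C]_(m, n)) : cmx (adjmx A) = A^T.
Proof. by rewrite /adjmx map_trmx cmxK. Qed.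

Lemma adjmx_diag n (d : 'rV[C]_n) : adjmx (diag_mx d) = diag_mx (cmx d).
Proof. by rewrite /adjmx map_diag_mx tr_diag_mx. Qed.

(** * Spectral theorem, square roots and polar decomposition *)

Lemma unitary_diagonalization n (A : 'M[C]_n) :
  A *m adjmx A = adjmx A *m A ->
  exists (P : 'M[C]_n) (d : 'rV[C]_n), [/\ P *m adjmx P = 1%:M, adjmx P *m P = 1%:M
                & A = adjmx P *m diag_mx d *m P].
Proof.
rewrite adjmxE => /normalmxP/orthomx_spectralP defA.
have Pu := spectral_unitarymx A.
have PP : spectralmx A *m adjmx (spectralmx A) = 1%:M.
  by rewrite adjmxE; apply/unitarymxP.
exists (spectralmx A), (spectral_diag A); split=> //; first exact: mulmx1C.
by rewrite adjmxE -invmx_unitary.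
Qed.

(** Entrywise, commutation says that [d 0 i = d 0 j] wherever [Z i j] is nonzero, and [f] preserves
    these equalities. It serves to pass from a diagonal matrix to its square root. *)
Lemma comm_diag_map n (f : C -> C) (d : 'rV[C]_n) (Z : 'M[C]_n) :
  Z *m diag_mx d = diag_mx d *m Z ->
  Z *m diag_mx (map_mx f d) = diag_mx (map_mx f d) *m Z.
Proof.
move=> /matrixP Zd; apply/matrixP=> i j.
have := Zd i j; rewrite !mul_mx_diag !mul_diag_mx !mxE.
have [->|Znz] := eqVneq (Z i j) 0; first by rewrite !mulr0 !mul0r.
by rewrite mulrC => /(mulIf Znz) ->; rewrite mulrC.
Qed.

(* The square root is a function of [U], hence symmetric like [U]. *)
Lemma symmetric_unitary_factor n (U : 'M[C]_n) :
  U *m adjmx U = 1%:M -> U^T = U ->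
  exists2 W : 'M[C]_n, W *m adjmx W = 1%:M & U = W *m W^T.
Proof.
move=> Uu Us.
have [|P [d [PP' P'P defU]]] := @unitary_diagonalization n U.
  by rewrite Uu (mulmx1C Uu).
pose e := map_mx (fun z : C => sqrtC z) d.
have ee : diag_mx e *m diag_mx e = diag_mx d.
  by rewrite mulmx_diag; congr diag_mx; apply/rowP=> i; rewrite !mxE -expr2 sqrtCK.
have cP : cmx P *m P^T = 1%:M by rewrite -cmx_adjmx -map_mxM PP' map_mx1.
have PT : P^T *m cmx P = 1%:M by exact: mulmx1C.
(* The symmetry of [U] says that [P P^T] commutes with [diag_mx d], hence with [diag_mx e]; read
   backwards, the latter is the symmetry of [W]. *)
have Zd : P *m P^T *m diag_mx d = diag_mx d *m (P *m P^T).
  have : P *m U^T *m P^T = P *m U *m P^T by rewrite Us.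
  rewrite defU !trmx_mul tr_adjmx tr_diag_mx !mulmxA PP' mul1mx.
  by rewrite -!mulmxA cP mulmx1 !mulmxA.
have /(_ (fun z : C => sqrtC z)) := comm_diag_map _ Zd.
rewrite -/e => Ze.
pose W := adjmx P *m diag_mx e *m P.
have WT : W^T = W.
  rewrite /W !trmx_mul tr_adjmx tr_diag_mx !mulmxA.
  rewrite -[LHS]mul1mx -P'P -[LHS]mulmxA ![P *m _]mulmxA Ze !mulmxA.
  by rewrite -[_ *m P^T *m _]mulmxA PT mulmx1.
exists W.
  (* The eigenvalues of the unitary [U] have modulus 1, so their square roots do too. *)
  have de1 : diag_mx e *m diag_mx (cmx e) = 1%:M.
    have dd : diag_mx d *m adjmx (diag_mx d) = 1%:M.
      have -> : diag_mx d = P *m U *m adjmx P.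
        by rewrite defU !mulmxA PP' mul1mx -mulmxA PP' mulmx1.
      rewrite !adjmxM adjmxK !mulmxA -[_ *m adjmx P *m P]mulmxA P'P mulmx1.
      by rewrite -[P *m U *m _]mulmxA Uu mulmx1.
    apply/matrixP=> i j; move/matrixP: dd => /(_ i j).
    rewrite adjmx_diag !mulmx_diag !mxE; case: eqP => // _.
    rewrite !mulr1n => dd.
    have {}dd : d 0 i * (d 0 i)^* = 1 by exact: dd.
    suff : sqrtC (d 0 i) * (sqrtC (d 0 i))^* = 1 by [].
    apply/eqP; rewrite -normCK -sqrp_eq1 ?exprn_ge0 ?normr_ge0 //.
    by rewrite -normrX sqrtCK normCK dd.
  rewrite /W !adjmxM adjmxK adjmx_diag !mulmxA -[_ *m P *m adjmx P]mulmxA PP'.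
  by rewrite mulmx1 -[adjmx P *m _ *m _]mulmxA de1 mulmx1.
rewrite WT /W !mulmxA -[_ *m P *m adjmx P]mulmxA PP' mulmx1.
by rewrite -[adjmx P *m _ *m _]mulmxA ee.
Qed.

(** [H] is a function of [S S^dagger], obtained by taking roots of its eigenvalues; this is why it
    commutes with all that commutes with [S S^dagger]. *)
Lemma positive_square_root n (S : 'M[C]_n) : S \in unitmx ->
  exists H : 'M[C]_n, [/\ adjmx H = H, H *m H = S *m adjmx S, H \in unitmx
    & forall Y, Y *m (S *m adjmx S) = S *m adjmx S *m Y -> Y *m H = H *m Y].
Proof.
move=> Su; set G := S *m adjmx S.
have GH : adjmx G = G by rewrite adjmxM adjmxK.
have [|P [d [PP' P'P defG]]] := @unitary_diagonalization n G; first by rewrite GH.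
pose e := map_mx (fun z : C => sqrtC z) d.
have ee : diag_mx e *m diag_mx e = diag_mx d.
  by rewrite mulmx_diag; congr diag_mx; apply/rowP=> i; rewrite !mxE -expr2 sqrtCK.
(* In the eigenbasis [S S^dagger] is again of the form [Z Z^dagger], whose diagonal entries are sums
   of squared moduli. The roots are then real and [H] is Hermitian. *)
have d_ge0 i : 0 <= d 0 i.
  have : diag_mx d = (P *m S) *m adjmx (P *m S).
    rewrite adjmxM !mulmxA -[P *m S *m _]mulmxA -/G defG !mulmxA PP' mul1mx.
    by rewrite -mulmxA PP' mulmx1.
  move: (P *m S) => Z /matrixP/(_ i i); rewrite !mxE eqxx mulr1n => ->.
  by apply: sumr_ge0 => j _; rewrite !mxE; apply: mulcJ_ge0.
have ce : cmx e = e.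
  apply/rowP=> i; rewrite !mxE; apply/CrealP.
  by rewrite ger0_real // sqrtC_ge0.
have HH : (adjmx P *m diag_mx e *m P) *m (adjmx P *m diag_mx e *m P) = G.
  rewrite !mulmxA -[_ *m P *m adjmx P]mulmxA PP' mulmx1.
  by rewrite -[adjmx P *m _ *m _]mulmxA ee.
exists (adjmx P *m diag_mx e *m P); split=> //.
- by rewrite !adjmxM adjmxK adjmx_diag ce mulmxA.
- have: G \in unitmx.
    by rewrite unitmx_mul Su /adjmx unitmx_tr map_unitmx.
  by rewrite -HH unitmx_mul => /andP[].
- move=> Y YG.
  have Yd : (P *m Y *m adjmx P) *m diag_mx d =
            diag_mx d *m (P *m Y *m adjmx P).
    have : P *m (Y *m G) *m adjmx P = P *m (G *m Y) *m adjmx P by rewrite YG.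
    rewrite defG !mulmxA PP' mul1mx => <-.
    by rewrite -[_ *m P *m adjmx P]mulmxA PP' mulmx1.
  have /(_ (fun z : C => sqrtC z)) := comm_diag_map _ Yd; rewrite -/e => Ye.
  have : adjmx P *m (P *m Y *m adjmx P *m diag_mx e) *m P =
         adjmx P *m (diag_mx e *m (P *m Y *m adjmx P)) *m P by rewrite Ye.
  rewrite !mulmxA P'P mul1mx => ->.
  by rewrite -[_ *m adjmx P *m P]mulmxA P'P mulmx1.
Qed.

(* Polar decomposition: [S S^dagger] commutes with every Hermitian [S X S^-1],
   hence so does the Hermitian factor of [S], which can be dropped. *)
Lemma unitary_similarity n (S : 'M[C]_n) : S \in unitmx ->
  exists2 W : 'M[C]_n, W *m adjmx W = 1%:M &
    forall X, adjmx X = X -> adjmx (S *m X *m invmx S) = S *m X *m invmx S ->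
      adjmx W *m X *m W = S *m X *m invmx S.
Proof.
move=> Su; have [H [Hh HH Hu Hc]] := positive_square_root Su.
have Vh : adjmx (invmx H) = invmx H.
  apply: (can_inj (mulKmx Hu)); rewrite mulmxV //.
  by rewrite -{1}Hh -adjmxM mulVmx // /adjmx map_mx1 trmx1.
(* This is the polar form [S = H W^dagger]. *)
exists (adjmx (invmx H *m S)).
  rewrite adjmxK; apply: mulmx1C; rewrite adjmxM Vh mulmxA -[_ *m S *m _]mulmxA.
  by rewrite -HH mulKmx // mulmxV.
move=> X Xh; set Y := S *m X *m _ => Yh; rewrite adjmxK.
have SX : S *m X = Y *m S by rewrite /Y mulmxKV.
(* The adjoint of [SX], as [X] and [Y] are Hermitian. Together they give [Y S S^dagger = S X
   S^dagger = S S^dagger Y]. *)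
have XS : X *m adjmx S = adjmx S *m Y.
  by rewrite -{1}Xh -adjmxM SX adjmxM Yh.
have YH : Y *m H = H *m Y.
  by apply: Hc; rewrite mulmxA -SX -!mulmxA XS.
rewrite adjmxM Vh !mulmxA -[_ *m S *m X]mulmxA SX mulmxA -[_ *m S *m _]mulmxA -HH.
by rewrite mulmxA mulmxK // -[_ *m Y *m _]mulmxA YH mulKmx.
Qed.

(** Over the complex numbers the matrix is Hermitian, so it is similar to a real diagonal matrix; a
    complex similarity between real matrices can be replaced by a real one. *)
Lemma real_symmetric_diagonalization n (A : 'M[R]_n) : A^T = A ->
  exists (P : 'M[R]_n) (d : 'rV[R]_n), P \in unitmx /\ P *m A = diag_mx d *m P.
Proof.
move=> As; pose B : 'M[C]_n := map_mx (@rC R) A.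
have realr (x : R) : rC x \is Num.real by apply/complex_realP; exists x.
have realB m p (X : 'M[R]_(m, p)) : map_mx (@rC R) X \is a mxOver Num.real.
  by apply/mxOverP=> i j; rewrite mxE.
have Bh : B \is hermsymmx.
  apply: realsym_hermsym; last exact: realB.
  by apply/is_hermitianmxP; rewrite expr0 scale1r map_mx_id // map_trmx As.
have defB := orthomx_spectralP (hermitian_normalmx Bh).
have := hermitian_spectral_diag_real Bh => /mxOverP dr.
pose d := map_mx (@complex.Re R) (spectral_diag B).
have dE : spectral_diag B = map_mx (@rC R) d.
  by apply/rowP=> i; rewrite !mxE [RHS]RRe_real.
have simB : similar_in unitmx B (diag_mx (spectral_diag B)).
  exists (spectralmx B); first exact: spectral_unit.
  apply/similarP; first exact: spectral_unit.
  by rewrite {2}defB !mulmxA mulmxV ?mul1mx // spectral_unit.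
have diagr : diag_mx (spectral_diag B) \is a mxOver Num.real.
  by rewrite dE -map_diag_mx; apply: realB.
have [Q] := real_similar simB (realB _ _ A) diagr.
rewrite inE => /andP[/mxOverP Qr Qu] /(similarP Qu) QB.
pose P := map_mx (@complex.Re R) Q.
have QE : Q = map_mx (@rC R) P.
  by apply/matrixP=> i j; rewrite !mxE [RHS]RRe_real.
exists P, d; split; first by rewrite -(map_unitmx (@rC R)) -QE.
have := QB; rewrite QE dE -map_diag_mx -!map_mxM => /matrixP PA.
by apply/matrixP=> i j; have := PA i j; rewrite !mxE => /complexI.
Qed.

(** Both equations force [cmx Y = - Y], so [-iY] is real. Unlike the existential form, they are easy
    to transport by unitary conjugation. *)
Lemma i_antisymP n (Y : 'M[C]_n) : i_antisym Y <-> adjmx Y = Y /\ Y^T = - Y.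
Proof.
split=> [[A [At ->]]|[Yh Ya]].
  rewrite /adjmx map_mxZ /= cconjI -map_mx_comp (eq_map_mx _ cconj_rC) !linearZ /=.
  by rewrite !map_trmx At map_mxN; split; rewrite !(scaleNr, scalerN) ?opprK.
have cY : cmx Y = - Y by rewrite -Ya -{2}Yh tr_adjmx.
pose Z := - cI R *: Y.
have cZ i j : rC (complex.Re (Z i j)) = Z i j.
  apply: cconj_real; have /matrixP/(_ i j) := cY; rewrite !mxE => cYij.
  by rewrite rmorphM rmorphN /= cconjI cYij mulrN !mulNr opprK.
exists (map_mx (@complex.Re R) Z).
have ZE : map_mx (@rC R) (map_mx (@complex.Re R) Z) = Z.
  by apply/matrixP=> i j; rewrite -[RHS]cZ !mxE.
split; last by rewrite ZE scalerA mulrN mulCI opprK scale1r.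
apply/matrixP=> i j; rewrite !mxE.
have /matrixP/(_ i j) := Ya; rewrite !mxE => ->.
by rewrite mulrN; case: (_ * _).
Qed.

Lemma tr_antisym n (Y : 'M[C]_n) : Y^T = - Y -> \tr Y = 0.
Proof.
move=> Ya; apply/eqP; have := congr1 (fun X => \tr X) Ya.
rewrite mxtrace_tr linearN /= => /eqP; rewrite -addr_eq0 -mulr2n.
by rewrite mulrn_eq0.
Qed.

End ComplexMatrices.

(** * Coordinates in the Gell-Mann basis *)
Section GellMann.
Context (R : realType) (N : nat) (hN : (2 <= N)%N).
Local Notation C := (R[i]).
Local Notation cmx A := (map_mx (@cconj R) A).
Context (lam : 'I_(ng N) -> 'M[C]_N) (hlam : gell_mann_basis lam).
Implicit Types (X Y : 'M[C]_N) (v w : 'cV[R]_(ng N)).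

Lemma two_neq0 : (2%:R : C) != 0.
Proof. by rewrite pnatr_eq0. Qed.

Lemma tr_combination (c : 'I_(ng N) -> C) b :
  \tr ((\sum_a c a *: lam a) *m lam b) = c b *+ 2.
Proof.
have [_ _ orth _ _] := hlam; rewrite mulmx_suml raddf_sum (bigD1 b) //=.
rewrite big1 ?addr0 => [|a ab]; rewrite -scalemxAl linearZ /= orth.
  by rewrite eqxx mulrnAr mulr1.
by rewrite (negPf ab) mul0rn mulr0.
Qed.

Lemma tr_sum_lam (c : 'I_(ng N) -> C) : \tr (\sum_a c a *: lam a) = 0.
Proof.
have [_ tr0 _ _ _] := hlam; rewrite raddf_sum big1 // => a _.
by rewrite /= linearZ /= tr0 mulr0.
Qed.

Lemma combination_inj (c : 'I_(ng N) -> C) :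
  \sum_a c a *: lam a = 0 -> forall a, c a = 0.
Proof.
move=> c0 a; apply/eqP; have := tr_combination c a.
by rewrite c0 mul0mx linear0 => /esym/eqP; rewrite mulrn_eq0.
Qed.

Lemma mxvec_combination (u : 'rV[C]_(ng N)) :
  u *m (\matrix_a mxvec (lam a)) = mxvec (\sum_a u 0 a *: lam a).
Proof.
rewrite mulmx_sum_row raddf_sum; apply: eq_bigr => a _.
by rewrite rowK -linearZ.
Qed.

(** A dimension count: the generators and the identity are [ng N + 1 = N^2] independent matrices,
    hence span. The trace removes the identity component, and orthogonality yields the other
    coefficients. *)
Lemma lam_complete X : \tr X = 0 ->
  X = \sum_a (\tr (X *m lam a) / 2%:R) *: lam a.
Proof.
move=> X0; pose G := col_mx (\matrix_a mxvec (lam a)) (mxvec (1%:M : 'M[C]_N)).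
have GE (u1 : 'rV[C]_(ng N)) (u2 : 'rV[C]_1) :
    row_mx u1 u2 *m G = mxvec (\sum_a u1 0 a *: lam a + u2 0 0 *: 1%:M).
  rewrite mul_row_col mxvec_combination linearD /=; congr (_ + _).
  by rewrite {1}[u2]mx11_scalar mul_scalar_mx -linearZ.
have trE (c : 'I_(ng N) -> C) z : \tr (\sum_a c a *: lam a + z *: 1%:M) = z *+ N.
  by rewrite linearD /= tr_sum_lam add0r linearZ /= mxtrace1 mulr_natr.
have N0 (z : C) : z *+ N = 0 -> z = 0.
  by move/eqP; rewrite mulrn_eq0 -leqn0 leqNgt (ltnW hN) => /eqP.
have Gfree : row_free G.
  apply: inj_row_free => u; rewrite -[u]hsubmxK GE.
  move=> /(congr1 (@vec_mx _ _ _)); rewrite mxvecK linear0.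
  move: (lsubmx u) (rsubmx u) => u1 u2 u0.
  have z0 : u2 0 0 = 0.
    by apply: N0; rewrite -(trE (fun a => u1 0 a)) u0 linear0.
  have u10 : u1 = 0.
    apply/rowP=> a; rewrite mxE.
    by apply: (@combination_inj (fun a => u1 0 a)); move: u0; rewrite z0 scale0r addr0.
  by rewrite u10 [u2]mx11_scalar z0 raddf0 row_mx0.
have : row_full G.
  rewrite /row_full (eqP Gfree) /ng subnK ?mulnn //.
  by rewrite expn_gt0 (ltnW hN).
move=> Gfull; have /submxP[u] := submx_full (mxvec X) Gfull.
rewrite -[u]hsubmxK GE => /(congr1 (@vec_mx _ _ _)); rewrite !mxvecK.
move: (lsubmx u) (rsubmx u) => u1 u2 uX.
have z0 : u2 0 0 = 0 by apply: N0; rewrite -(trE (fun a => u1 0 a)) -uX.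
move: uX; rewrite z0 scale0r addr0 => {X0} ->; apply: eq_bigr => a _.
by rewrite (tr_combination (fun a => u1 0 a)) -[u1 0 a *+ 2]mulr_natr mulfK // two_neq0.
Qed.

Lemma VgenD v w : Vgen lam (v + w) = Vgen lam v + Vgen lam w.
Proof.
rewrite /Vgen -big_split; apply: eq_bigr => i _ /=.
by rewrite mxE rmorphD scalerDl.
Qed.

Lemma VgenZ (c : R) v : Vgen lam (c *: v) = rC c *: Vgen lam v.
Proof.
rewrite /Vgen scaler_sumr; apply: eq_bigr => i _.
by rewrite mxE rmorphM scalerA.
Qed.

Lemma VgenN v : Vgen lam (- v) = - Vgen lam v.
Proof. by rewrite -scaleN1r VgenZ rmorphN rmorph1 scaleN1r. Qed.

Lemma Vgen0 : Vgen lam 0 = 0.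
Proof. by rewrite -(scale0r (0 : 'cV_(ng N))) VgenZ rmorph0 scale0r. Qed.

Lemma Vgen_sum (I : finType) (F : I -> 'cV[R]_(ng N)) :
  Vgen lam (\sum_i F i) = \sum_i Vgen lam (F i).
Proof. by apply: (big_morph _ VgenD Vgen0). Qed.

Lemma Vgen_inj : injective (Vgen lam).
Proof.
move=> v w vw; apply/eqP; rewrite -subr_eq0; apply/eqP/colP=> i; rewrite [RHS]mxE.
apply: (@rC_inj R); apply: (@combination_inj (fun i => rC ((v - w) i 0))).
by rewrite -/(Vgen lam (v - w)) VgenD VgenN vw subrr.
Qed.

Lemma tr_Vgen v : \tr (Vgen lam v) = 0.
Proof. exact: tr_sum_lam. Qed.

Lemma adjmx_Vgen v : adjmx (Vgen lam v) = Vgen lam v.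
Proof.
have [herm _ _ _ _] := hlam; rewrite /adjmx /Vgen map_mx_sum raddf_sum.
apply: eq_bigr => i _ /=; rewrite map_mxZ linearZ /= cconj_rC.
by rewrite -/(adjmx _) herm.
Qed.

(** Up to the factor 2, [Vgen] is an isometry onto its image with the trace form, so orthogonality
    can be checked on either side. *)
Lemma tr_VgenM v w : \tr (Vgen lam v *m Vgen lam w) = rC ((v^T *m w) 0 0 *+ 2).
Proof.
rewrite {2}/Vgen mulmx_sumr raddf_sum !mxE -sumrMnl rmorph_sum /=.
apply: eq_bigr => i _; rewrite -scalemxAr linearZ /= tr_combination mxE.
by rewrite rmorphMn rmorphM /= mulrnAr mulrC.
Qed.

(** Taking real parts makes this total with real values; nothing is lost on Hermitian [X], where the
    traces are already real. *)
Definition gcoord X : 'cV[R]_(ng N) :=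
  \col_a complex.Re (\tr (X *m lam a) / 2%:R).

Lemma gcoordK X : adjmx X = X -> \tr X = 0 -> Vgen lam (gcoord X) = X.
Proof.
have [herm _ _ _ _] := hlam => Xh X0; rewrite {2}[X]lam_complete //.
apply: eq_bigr => a _; congr (_ *: _); rewrite mxE; apply: cconj_real.
rewrite rmorphM fmorphV rmorph_nat /= -trace_map_mx map_mxM.
by rewrite -mxtrace_tr trmx_mul -!/(adjmx _) herm Xh mxtrace_mulC.
Qed.

Lemma in_WP (v : 'I_(nk N) -> 'cV[R]_(ng N)) X :
  in_W lam v X <-> exists c : 'I_(nk N) -> R, X = Vgen lam (\sum_a c a *: v a).
Proof.
by split=> -[c ->]; exists c; rewrite Vgen_sum; apply: eq_bigr => a _; rewrite VgenZ.
Qed.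

End GellMann.

(** * Polynomials in the bilinears *)
Section SesquilinearForms.
Context (C : numClosedFieldType) (N : nat).
Implicit Types (A G : 'M[C]_N).

(** Complex polarization, by evaluating at [x + y] and at [x + i y]. *)
Lemma sesquilinear_form_eq0 A :
  (forall x : 'cV[C]_N, \tr (A *m (x *m x^t*)) = 0) -> A = 0.
Proof.
move=> A0; pose h (x y : 'cV[C]_N) := \tr (A *m (x *m y^t*)).
have adjD (x y : 'cV[C]_N) c : (x + c *: y)^t* = x^t* + c^* *: y^t*.
  by rewrite linearD linearZ /= map_mxD map_mxZ.
have hE x y c : h x x + c^* * h x y + c * h y x + c * c^* * h y y = 0.
  rewrite -[RHS](A0 (x + c *: y)) adjD mulmxDl !mulmxDr.
  rewrite !linearD /= -?(scalemxAl, scalemxAr) !linearZ /= -!/(h _ _).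
  ring.
have h0 x : h x x = 0 by exact: A0.
have hxy x y : h x y = 0.
  (* The choice [c = 1] gives [h x y + h y x = 0], and [c = i] gives [h y x = h x y]. *)
  have := hE x y 1; have := hE x y 'i; rewrite !h0 !mulr0 !addr0 !add0r.
  rewrite rmorph1 conjCi !mul1r mulNr => /eqP; rewrite addrC subr_eq0 => /eqP e.
  have {e} -> : h y x = h x y by apply: (mulfI (neq0Ci C)).
  by move/eqP; rewrite -mulr2n mulrn_eq0 => /eqP.
apply/matrixP=> i j; rewrite mxE -(hxy (delta_mx j 0) (delta_mx i 0)).
rewrite /h trmx_delta map_delta_mx mulmxA mxtrace_mulC -colE -rowE.
by rewrite /mxtrace big_ord1 !mxE.
Qed.

Context (n : nat) (lam : 'I_n -> 'M[C]_N).

(** The bilinears [K_a], viewed as linear functions of the Gram matrix [G = Phi Phi^dagger]. *)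
Definition kvec G : 'cV[C]_n := \col_a \tr (lam a *m G).

Lemma kvecD G G' : kvec (G + G') = kvec G + kvec G'.
Proof. by apply/colP=> a; rewrite !mxE mulmxDr linearD. Qed.

Lemma kvecZ c G : kvec (c *: G) = c *: kvec G.
Proof. by apply/colP=> a; rewrite !mxE -scalemxAr linearZ. Qed.

Lemma mul_kvec (u : 'rV[C]_n) G :
  (u *m kvec G) 0 0 = \tr ((\sum_a u 0 a *: lam a) *m G).
Proof.
rewrite mulmx_suml raddf_sum mxE; apply: eq_bigr => a _.
by rewrite mxE /= -scalemxAl linearZ.
Qed.

Context (N_gt0 : (0 < N)%N).
Context (tr_lam : forall a, \tr (lam a) = 0).
Context (lam_free :
  forall c : 'I_n -> C, \sum_a c a *: lam a = 0 -> forall a, c a = 0).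

Lemma combination_form_eq0 (u : 'rV[C]_n) :
  (forall x : 'cV[C]_N, (u *m kvec (x *m x^t*)) 0 0 = 0) -> u = 0.
Proof.
move=> u0; apply/rowP=> a; rewrite mxE; apply: (lam_free (c := fun a => u 0 a)).
by apply: sesquilinear_form_eq0 => x; rewrite -mul_kvec.
Qed.

(* Scaling [Phi] separates the degrees; on [Phi = (x, y)] the quartic part
   polarizes to a form that is bilinear in [x x^dagger] and [y y^dagger]. *)
Lemma bilinear_polynomial_eq0 (m l : 'rV[C]_n) (Q : 'M[C]_n) :
  Q^T = Q ->
  (forall Phi : 'M[C]_(N, 2), let G := Phi *m Phi^t* in
    (m *m kvec G) 0 0 + \tr G * (l *m kvec G) 0 0
    + ((kvec G)^T *m Q *m kvec G) 0 0 = 0) ->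
  [/\ m = 0, l = 0 & Q = 0].
Proof.
move=> Qs H.
pose p G := (m *m kvec G) 0 0.
pose q G := \tr G * (l *m kvec G) 0 0 + ((kvec G)^T *m Q *m kvec G) 0 0.
have sE c (A : 'M[C]_1) : (c *: A) 0 0 = c * A 0 0 by rewrite mxE.
have dE (A B : 'M[C]_1) : (A + B) 0 0 = A 0 0 + B 0 0 by rewrite mxE.
have tr11 (A : 'M[C]_1) : A^T = A by rewrite [A]mx11_scalar tr_scalar_mx.
(* Doubling [Phi] multiplies [p] by 4 and [q] by 16; as [p + q] vanishes at both fields, so do [p]
   and [q]. *)
have pq (Phi : 'M[C]_(N, 2)) : p (Phi *m Phi^t*) = 0 /\ q (Phi *m Phi^t*) = 0.
  have := H Phi; have := H (2%:R *: Phi); rewrite /= -!addrA.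
  have -> : (2%:R *: Phi) *m (2%:R *: Phi)^t* = 4%:R *: (Phi *m Phi^t*).
    rewrite linearZ /= map_mxZ rmorph_nat -scalemxAl -scalemxAr scalerA.
    by rewrite -natrM.
  set G := Phi *m _; rewrite -!/(p _) -!/(q _).
  have -> : p (4%:R *: G) = 4%:R * p G by rewrite /p kvecZ -scalemxAr mxE.
  have -> : q (4%:R *: G) = 16%:R * q G.
    rewrite /q kvecZ !linearZ /= -!scalemxAl ?linearZ /= !sE; ring.
  move=> e1 /eqP; rewrite addr_eq0 => /eqP e2.
  move: e1; rewrite e2 mulrN addrC -mulrBl -natrB // => /eqP.
  by rewrite mulf_eq0 pnatr_eq0 /= => /eqP ->; rewrite oppr0.
(* The two doublet components supply two independent columns, so sums of two rank-one matrices are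
   Gram matrices of fields. *)
have rowE (x y : 'cV[C]_N) :
    x *m x^t* + y *m y^t* = row_mx x y *m (row_mx x y)^t*.
  by rewrite tr_row_mx map_col_mx mul_row_col.
have G2 (x y : 'cV[C]_N) :
    exists Phi : 'M[C]_(N, 2), x *m x^t* + y *m y^t* = Phi *m Phi^t*.
  by exists (row_mx x y); apply: rowE.
have G1 (x : 'cV[C]_N) : exists Phi : 'M[C]_(N, 2), x *m x^t* = Phi *m Phi^t*.
  by have := G2 x 0; rewrite mul0mx addr0.
have m0 : m = 0.
  apply: combination_form_eq0 => x; have [Phi ->] := G1 x.
  by have [] := pq Phi.
(* For fixed [x], the mixed part of [q (X + Y)] is a sesquilinear form in [y] that vanishes on the
   diagonal; its matrix is therefore zero. *)
have cross (x : 'cV[C]_N) :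
    let X := x *m x^t* in
    \sum_a (\tr X *: l + 2%:R *: ((kvec X)^T *m Q)) 0 a *: lam a
    + (l *m kvec X) 0 0 *: 1%:M = 0.
  move=> X; apply: sesquilinear_form_eq0 => y; set Y := y *m _.
  have qX : q X = 0 by rewrite /X; have [Phi ->] := G1 x; have [] := pq Phi.
  have qY : q Y = 0 by rewrite /Y; have [Phi ->] := G1 y; have [] := pq Phi.
  have : q (X + Y) = 0.
    by rewrite /X /Y; have [Phi ->] := G2 x y; have [] := pq Phi.
  rewrite mulmxDl linearD /= -mul_kvec -scalemxAl mul1mx linearZ /=.
  rewrite mulmxDl -!scalemxAl.
  have -> : q (X + Y) = q X + q Y + (\tr X * (l *m kvec Y) 0 0
     + 2%:R * ((kvec X)^T *m Q *m kvec Y) 0 0 + (l *m kvec X) 0 0 * \tr Y).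
    rewrite /q kvecD !linearD /= !(mulmxDl, mulmxDr) !dE.
    have -> : (kvec Y)^T *m Q *m kvec X = (kvec X)^T *m Q *m kvec Y.
      by rewrite -[RHS]tr11 !trmx_mul trmxK Qs mulmxA.
    ring.
  by rewrite qX qY !add0r !dE !sE.
have tr_comb (c : 'I_n -> C) : \tr (\sum_a c a *: lam a) = 0.
  by rewrite raddf_sum big1 // => a _; rewrite /= linearZ /= tr_lam mulr0.
(* The trace of [cross] kills the traceless generators and leaves [N] times [l *m kvec X]. *)
have l0 : l = 0.
  apply: combination_form_eq0 => x; have /= := cross x.
  set X := x *m _ => /(congr1 (@mxtrace _ _)).
  rewrite linearD /= tr_comb add0r linearZ /= mxtrace1 mxtrace0 => /eqP.
  by rewrite mulf_eq0 pnatr_eq0 -leqn0 leqNgt N_gt0 orbF => /eqP.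
(* With [l = 0], freeness of the generators in [cross] leaves [(kvec X)^T *m Q = 0]. *)
split=> //; apply/row_matrixP=> b; rewrite row0.
apply: combination_form_eq0 => x; have /= := cross x.
rewrite l0 mul0mx [(0 : 'M_1) 0 0]mxE scale0r addr0 scaler0 add0r.
set X := x *m _ => /lam_free/(_ b); rewrite mxE => /eqP.
rewrite mulf_eq0 pnatr_eq0 /= => /eqP <-.
rewrite !mxE; apply: eq_bigr => a _.
by rewrite -{1}Qs !mxE mulrC.
Qed.

End SesquilinearForms.

(** * The action of a CP transformation *)
Lemma mulmx_cV_ext (F : nzRingType) (m n : nat) (A B : 'M[F]_(m, n)) :
  (forall v : 'cV[F]_n, A *m v = B *m v) -> A = B.
Proof.
move=> AB; apply/matrixP=> i j.
by have /colP/(_ i) := AB (delta_mx j 0); rewrite -!colE !mxE.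
Qed.

Lemma bilinear_polynomialB (F : comNzRingType) (n : nat) (t : F)
    (m m' l l' : 'rV[F]_n) (Q Q' : 'M[F]_n) (k : 'cV[F]_n) :
  (m *m k) 0 0 + t * (l *m k) 0 0 + (k^T *m Q *m k) 0 0 =
  (m' *m k) 0 0 + t * (l' *m k) 0 0 + (k^T *m Q' *m k) 0 0 ->
  ((m - m') *m k) 0 0 + t * ((l - l') *m k) 0 0 + (k^T *m (Q - Q') *m k) 0 0 = 0.
Proof.
have dE (A B : 'M[F]_1) : (A - B) 0 0 = A 0 0 - B 0 0 by rewrite !mxE.
move=> e; rewrite !(mulmxBl, mulmxBr) !dE mulrBr.
rewrite [X in X + _]addrACA [LHS]addrACA -opprD -opprD.
by apply/eqP; rewrite subr_eq0; apply/eqP.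
Qed.

Section CPAction.
Context (R : realType) (N : nat) (hN : (2 <= N)%N).
Local Notation C := (R[i]).
Local Notation cmx A := (map_mx (@cconj R) A).
Context (lam : 'I_(ng N) -> 'M[C]_N) (hlam : gell_mann_basis lam).
Implicit Types (A X Y G : 'M[C]_N) (v w : 'cV[R]_(ng N)) (Phi : 'M[C]_(N, 2)).

Lemma Kbil_tr A Phi : Kbil A Phi = \tr (A *m (Phi *m adjmx Phi)).
Proof.
rewrite /Kbil; apply: eq_bigr => i _; rewrite mxE; apply: eq_bigr => j _.
rewrite mxE mulr_sumr; apply: eq_bigr => al _.
by rewrite !mxE [_ * A i j]mulrC -mulrA [_ * Phi j al]mulrC.
Qed.

Lemma K0_tr Phi : K0 Phi = \tr (Phi *m adjmx Phi).
Proof.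
rewrite /K0; apply: eq_bigr => i _; rewrite mxE; apply: eq_bigr => al _.
by rewrite !mxE mulrC.
Qed.

(** The first two terms depend on [\tr G] alone, which the CP map preserves; the bracket has the
    shape of [bilinear_polynomial_eq0]. *)
Lemma potentialE M0 Lam0 M L (Lam : 'M[R]_(ng N)) Phi :
  let G := Phi *m adjmx Phi in
  potential lam M0 Lam0 M L Lam Phi =
  rC M0 * \tr G + rC Lam0 * \tr G ^+ 2
  + ((map_mx rC (\row_a M a) *m kvec lam G) 0 0
     + \tr G * (map_mx rC (\row_a L a) *m kvec lam G) 0 0
     + ((kvec lam G)^T *m map_mx rC Lam *m kvec lam G) 0 0).
Proof.
move=> G; rewrite /potential K0_tr -/G.
have -> : (map_mx rC (\row_a M a) *m kvec lam G) 0 0 =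
          \sum_a rC (M a) * Kbil (lam a) Phi.
  by rewrite mxE; apply: eq_bigr => a _; rewrite !mxE Kbil_tr.
have -> : \tr G * (map_mx rC (\row_a L a) *m kvec lam G) 0 0 =
          \sum_a rC (L a) * \tr G * Kbil (lam a) Phi.
  rewrite mxE mulr_sumr; apply: eq_bigr => a _.
  by rewrite !mxE Kbil_tr mulrCA mulrA.
have -> : ((kvec lam G)^T *m map_mx rC Lam *m kvec lam G) 0 0 =
          \sum_a \sum_b rC (Lam a b) * Kbil (lam a) Phi * Kbil (lam b) Phi.
  rewrite mxE exchange_big; apply: eq_bigr => b _ /=; rewrite mxE mulr_suml.
  by apply: eq_bigr => a _; rewrite !mxE !Kbil_tr [_ * rC _]mulrC.
by rewrite !addrA; congr (_ + _ + _); rewrite addrAC.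
Qed.

(** A quadratic form determines only the symmetric part of its matrix, whence the symmetry
    hypotheses. *)
Lemma potential_inj M0 Lam0 M L (Lam : 'M[R]_(ng N)) M' L' (Lam' : 'M[R]_(ng N)) :
  Lam^T = Lam -> Lam'^T = Lam' ->
  (forall Phi, potential lam M0 Lam0 M L Lam Phi =
               potential lam M0 Lam0 M' L' Lam' Phi) ->
  [/\ \row_a M a = \row_a M' a, \row_a L a = \row_a L' a & Lam = Lam'].
Proof.
move=> Ls Ls' eqV.
have rCinj m n (A B : 'M[R]_(m, n)) : map_mx rC A - map_mx rC B = 0 -> A = B.
  move/eqP; rewrite subr_eq0 => /eqP/matrixP e; apply/matrixP=> i j.
  by apply: (@rC_inj R); have := e i j; rewrite !mxE.
have [_ tr0 _ _ _] := hlam.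
have [] := bilinear_polynomial_eq0 (ltnW hN) tr0 (combination_inj hlam)
  (m := map_mx rC (\row_a M a) - map_mx rC (\row_a M' a))
  (l := map_mx rC (\row_a L a) - map_mx rC (\row_a L' a))
  (Q := map_mx rC Lam - map_mx rC Lam').
- by rewrite linearB /= !map_trmx Ls Ls'.
- move=> Phi; rewrite -adjmxE; set G := Phi *m _ => /=.
  have := eqV Phi; rewrite !potentialE -/G => /addrI.
  exact: bilinear_polynomialB.
by move=> /rCinj-> /rCinj-> /rCinj->.
Qed.

(** * The involution dual to an order-2 CP map *)

Context (U : 'M[C]_N) (U_unitary : U *m adjmx U = 1%:M)
  (U_order2 : U *m cmx U = 1%:M).

(** The CP map moved from the fields to the matrix of a bilinear, as [tr_cp_bilinear] shows; this is
    [sigma] of the overview. *)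
Definition cp_dual X : 'M[C]_N := U *m X^T *m cmx U.

(** [adjmx U] and [cmx U] are both inverse to [U], so they agree. *)
Lemma cp_sym : U^T = U.
Proof.
have VU : adjmx U = cmx U.
  by rewrite -[LHS]mul1mx -(mulmx1C U_order2) -mulmxA U_unitary mulmx1.
by rewrite -[LHS]cmx_adjmx VU cmxK.
Qed.

Lemma mul_cmxU : cmx U *m U = 1%:M.
Proof. exact: mulmx1C. Qed.

Lemma cp_dualK : involutive cp_dual.
Proof.
move=> X; rewrite /cp_dual !trmx_mul trmxK map_trmx cp_sym !mulmxA U_order2.
by rewrite mul1mx -mulmxA U_order2 mulmx1.
Qed.

Lemma cp_dualZ c X : cp_dual (c *: X) = c *: cp_dual X.
Proof. by rewrite /cp_dual linearZ /= -scalemxAr -scalemxAl. Qed.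

Lemma cp_dual_sum (I : finType) (F : I -> 'M[C]_N) :
  cp_dual (\sum_i F i) = \sum_i cp_dual (F i).
Proof. by rewrite /cp_dual raddf_sum mulmx_sumr mulmx_suml. Qed.

Lemma cp_dualB X Y : cp_dual (X - Y) = cp_dual X - cp_dual Y.
Proof. by rewrite /cp_dual linearB mulmxBr mulmxBl. Qed.

(** The transpose reverses products. This sign change of commutators makes the (-1)-eigenspace a Lie
    algebra under [-i[X, Y]]. *)
Lemma cp_dualM X Y : cp_dual (X *m Y) = cp_dual Y *m cp_dual X.
Proof.
rewrite /cp_dual trmx_mul !mulmxA.
by rewrite -[_ *m cmx U *m U]mulmxA mul_cmxU mulmx1.
Qed.

Lemma tr_cp_dual X : \tr (cp_dual X) = \tr X.
Proof. by rewrite mxtrace_mulC mulmxA mul_cmxU mul1mx mxtrace_tr. Qed.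

Lemma adjmx_cp_dual X : adjmx X = X -> adjmx (cp_dual X) = cp_dual X.
Proof.
move=> Xh; rewrite /cp_dual !adjmxM mulmxA; congr (_ *m _ *m _).
- by rewrite /adjmx cmxK cp_sym.
- by rewrite -[in RHS]Xh tr_adjmx /adjmx map_trmx trmxK.
- by rewrite /adjmx map_trmx cp_sym.
Qed.

Lemma tr_cp_dualM X Y : \tr (cp_dual X *m Y) = \tr (X *m cp_dual Y).
Proof.
rewrite -mxtrace_tr /cp_dual !trmx_mul trmxK map_trmx cp_sym.
rewrite mxtrace_mulC -!mulmxA [RHS]mxtrace_mulC -!mulmxA.
by rewrite mxtrace_mulC -!mulmxA mxtrace_mulC -!mulmxA.
Qed.

Lemma tr_cp_bilinear A Phi :
  \tr (A *m ((U *m cmx Phi) *m adjmx (U *m cmx Phi))) =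
  \tr (cp_dual A *m (Phi *m adjmx Phi)).
Proof.
rewrite tr_cp_dualM /cp_dual adjmxM trmx_mul tr_adjmx !mulmxA.
by rewrite /adjmx cmxK map_trmx cp_sym.
Qed.

(** The matrix of [cp_dual] in Gell-Mann coordinates, real because [cp_dual] preserves Hermitian
    matrices. It is a symmetric involution, hence orthogonal. *)
Definition cp_mx : 'M[R]_(ng N) := \matrix_(b, a) gcoord lam (cp_dual (lam a)) b 0.

Lemma cp_dual_lam a : cp_dual (lam a) = \sum_b rC (cp_mx b a) *: lam b.
Proof.
have [herm tr0 _ _ _] := hlam.
rewrite -[LHS](gcoordK hN hlam) ?tr_cp_dual // ?adjmx_cp_dual //.
by apply: eq_bigr => b _; rewrite [cp_mx b a]mxE.
Qed.

Lemma Vgen_cp_mx v : Vgen lam (cp_mx *m v) = cp_dual (Vgen lam v).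
Proof.
rewrite /Vgen cp_dual_sum.
under [RHS]eq_bigr => a _ do rewrite cp_dualZ cp_dual_lam scaler_sumr.
rewrite exchange_big; apply: eq_bigr => b _ /=; rewrite mxE rmorph_sum scaler_suml.
by apply: eq_bigr => a _; rewrite rmorphM scalerA mulrC.
Qed.

Lemma cp_mxK : cp_mx *m cp_mx = 1%:M.
Proof.
apply: mulmx_cV_ext => v; apply: (Vgen_inj hlam).
by rewrite -mulmxA !Vgen_cp_mx cp_dualK mul1mx.
Qed.

Lemma tr_cp_mx : cp_mx^T = cp_mx.
Proof.
have dual v w : (v^T *m (cp_mx *m w)) 0 0 = ((cp_mx *m v)^T *m w) 0 0.
  apply: (@mulIf _ 2%:R); rewrite ?pnatr_eq0 // !mulr_natr; apply: (@rC_inj R).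
  by rewrite -!(tr_VgenM hlam) !Vgen_cp_mx tr_cp_dualM.
apply/matrixP=> i j; have := dual (delta_mx i 0) (delta_mx j 0).
by rewrite -!colE trmx_delta -rowE !mxE => ->.
Qed.

Lemma kvec_cp Phi :
  kvec lam ((U *m cmx Phi) *m adjmx (U *m cmx Phi)) =
  (map_mx rC cp_mx)^T *m kvec lam (Phi *m adjmx Phi).
Proof.
apply/colP=> a; rewrite [LHS]mxE tr_cp_bilinear cp_dual_lam mulmx_suml raddf_sum.
rewrite mxE; apply: eq_bigr => b _ /=.
by rewrite -scalemxAl linearZ /= ![_ a b]mxE [kvec _ _ _ _]mxE [map_mx _ _ _ _]mxE.
Qed.

Lemma potential_cp M0 Lam0 M L (Lam : 'M[R]_(ng N)) Phi :
  potential lam M0 Lam0 M L Lam (U *m cmx Phi) =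
  potential lam M0 Lam0 (fun b => (\row_a M a *m cp_mx) 0 b)
    (fun b => (\row_a L a *m cp_mx) 0 b) (cp_mx *m Lam *m cp_mx) Phi.
Proof.
have rowE (r : 'rV[R]_(ng N)) : \row_b r 0 b = r by apply/rowP=> b; rewrite mxE.
rewrite !potentialE !rowE kvec_cp map_trmx tr_cp_mx.
have -> : \tr ((U *m cmx Phi) *m adjmx (U *m cmx Phi)) = \tr (Phi *m adjmx Phi).
  rewrite -[X in \tr X]mul1mx tr_cp_bilinear /cp_dual trmx1 mulmx1 U_order2.
  by rewrite mul1mx.
by rewrite !map_mxM trmx_mul map_trmx tr_cp_mx !mulmxA.
Qed.

(** The transformed potential is again a potential, so its coefficients can be compared; [cp_mxK]
    turns invariance of [Lam] under conjugation into commutation. *)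
Lemma cp_invariantP M0 Lam0 M L (Lam : 'M[R]_(ng N)) : Lam^T = Lam ->
  (forall Phi, potential lam M0 Lam0 M L Lam (U *m cmx Phi) =
               potential lam M0 Lam0 M L Lam Phi) <->
  [/\ \row_a M a *m cp_mx = \row_a M a, \row_a L a *m cp_mx = \row_a L a
    & cp_mx *m Lam = Lam *m cp_mx].
Proof.
move=> Ls; have rowE (r : 'rV[R]_(ng N)) : \row_b r 0 b = r.
  by apply/rowP=> b; rewrite mxE.
split=> [inv|[eM eL eLam] Phi].
  have [|Phi|] := @potential_inj M0 Lam0
    (fun b => (\row_a M a *m cp_mx) 0 b) (fun b => (\row_a L a *m cp_mx) 0 b)
    (cp_mx *m Lam *m cp_mx) M L Lam _ Ls.
  - by rewrite !trmx_mul tr_cp_mx Ls mulmxA.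
  - by rewrite -potential_cp inv.
  rewrite !rowE => -> -> e; split=> //.
  by rewrite -{2}e -!mulmxA cp_mxK mulmx1.
rewrite potential_cp eM eL eLam -mulmxA cp_mxK mulmx1.
by rewrite !potentialE !rowE.
Qed.

End CPAction.

(** * The eigenspace of a CP2 symmetry *)
Lemma nk_le_ng (N : nat) : (2 <= N)%N -> (nk N <= ng N)%N.
Proof.
case: N => // n _; rewrite /nk /ng [(n.+1 - 1)%N]subn1 /=.
apply: leq_trans (leq_div _ _) _.
by rewrite -mulnn [(n.+1 * n.+1)%N]mulnS addSn subn1 /= leq_addl.
Qed.

(** For [U = W W^T], conjugation by [W] turns [cp_dual U] into the plain transpose, whose
    (-1)-eigenspace consists of the antisymmetric matrices. *)
Lemma antifixedP (R : realType) (N : nat) (W X : 'M[R[i]]_N) :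
  W *m adjmx W = 1%:M ->
  i_antisym (adjmx W *m X *m W) <->
  [/\ adjmx X = X, \tr X = 0 & cp_dual (W *m W^T) X = - X].
Proof.
move=> Wu; have Wu' : adjmx W *m W = 1%:M by exact: mulmx1C.
move YE: (adjmx W *m X *m W) => Y; have XE : X = W *m Y *m adjmx W.
  by rewrite -YE !mulmxA Wu mul1mx -mulmxA Wu mulmx1.
have sX : cp_dual (W *m W^T) X = W *m Y^T *m adjmx W.
  rewrite -YE /cp_dual map_mxM !trmx_mul tr_adjmx !mulmxA; congr (_ *m _).
  by rewrite /adjmx map_trmx.
rewrite i_antisymP; split=> [[Yh Ya]|[Xh X0 Xa]].
  split; first by rewrite XE !adjmxM adjmxK Yh mulmxA.
    by rewrite XE mxtrace_mulC mulmxA Wu' mul1mx tr_antisym.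
  by rewrite sX Ya mulmxN mulNmx -XE.
split; first by rewrite -YE !adjmxM adjmxK Xh mulmxA.
have -> : Y^T = adjmx W *m (cp_dual (W *m W^T) X) *m W.
  by rewrite sX !mulmxA Wu' mul1mx -mulmxA Wu' mulmx1.
by rewrite Xa mulmxN mulNmx YE.
Qed.

Section Main.
Context (R : realType) (N : nat) (hN : (2 <= N)%N).
Local Notation C := (R[i]).
Local Notation cmx A := (map_mx (@cconj R) A).
Context (lam : 'I_(ng N) -> 'M[C]_N) (hlam : gell_mann_basis lam).
Implicit Types (X Y : 'M[C]_N) (v : 'I_(nk N) -> 'cV[R]_(ng N)).

(** Its row space is the span of the [v a], so that membership in [W] becomes a row-space
    inclusion. *)
Let mx_of v := \matrix_(a < nk N, i < ng N) v a i 0.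

Lemma in_W_submx v X :
  in_W lam v X <-> exists2 x, X = Vgen lam x & (x^T <= mx_of v)%MS.
Proof.
have vE (c : 'rV[R]_(nk N)) : \sum_a c 0 a *: v a = (c *m mx_of v)^T.
  rewrite mulmx_sum_row raddf_sum; apply: eq_bigr => a _; rewrite /= linearZ /=.
  by congr (_ *: _); apply/colP=> i; rewrite !mxE.
rewrite in_WP; split=> [[c ->]|[x -> /submxP[c xE]]].
  exists (\sum_a c a *: v a) => //.
  rewrite (eq_bigr (fun a => (\row_a c a) 0 a *: v a)) => [|a _]; last by rewrite mxE.
  by rewrite vE trmxK submxMl.
by exists (fun a => c 0 a); rewrite vE -xE trmxK.
Qed.

Lemma antifixed_coord (U X : 'M[C]_N) :
  U *m adjmx U = 1%:M -> U *m cmx U = 1%:M ->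
  [/\ adjmx X = X, \tr X = 0 & cp_dual U X = - X] <->
  exists2 x, X = Vgen lam x & cp_mx lam U *m x = - x.
Proof.
move=> Uu U2; split=> [[Xh X0 Xa]|[x -> xa]].
  exists (gcoord lam X); first by rewrite gcoordK.
  by apply: (Vgen_inj hlam); rewrite Vgen_cp_mx // VgenN gcoordK.
split; [exact: adjmx_Vgen | exact: tr_Vgen | ].
by rewrite -Vgen_cp_mx // xa VgenN.
Qed.

Lemma symmetric_unitary (W : 'M[C]_N) : W *m adjmx W = 1%:M ->
  (W *m W^T) *m adjmx (W *m W^T) = 1%:M /\ (W *m W^T) *m cmx (W *m W^T) = 1%:M.
Proof.
move=> Wu; have Wu' : W^T *m cmx W = 1%:M.
  by rewrite -[W^T]cmx_adjmx -map_mxM (mulmx1C Wu) map_mx1.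
have e : (W *m W^T) *m cmx (W *m W^T) = 1%:M.
  rewrite map_mxM !mulmxA -[_ *m cmx W]mulmxA Wu' mulmx1.
  by rewrite -map_trmx -/(adjmx _).
split=> //; rewrite -[RHS]e; congr (_ *m _).
by rewrite /adjmx map_trmx trmx_mul trmxK.
Qed.

(** * Sufficiency of the two conditions *)

Lemma CP2_of_conditions M0 Lam0 M L (Lam : 'M[R]_(ng N)) v : Lam^T = Lam ->
  cond_i lam Lam v -> cond_ii M L v -> has_CP2 lam M0 Lam0 M L Lam.
Proof.
move=> Ls [_ veig _ [S [Su WS SW]]] ii.
have [W Wu WE] := unitary_similarity Su.
have [Uu U2] := symmetric_unitary Wu.
exists (W *m W^T); split=> //; apply/(cp_invariantP hN hlam Uu U2 _ _ _ _ Ls).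
set s := cp_mx lam _.
have Wh X : in_W lam v X -> adjmx W *m X *m W = S *m X *m invmx S.
  move=> XW; have /in_W_submx[x Xx _] := XW; apply: WE.
    by rewrite Xx adjmx_Vgen.
  by have /i_antisymP[] := WS _ XW.
(* The span of the [v a] is exactly the (-1)-eigenspace of [s]: after conjugation by the unitary
   [W], both correspond to [i so(N)]. *)
have anti (x : 'cV[R]_(ng N)) : (x^T <= mx_of v)%MS <-> s *m x = - x.
  split=> [xV|xa].
    have XW : in_W lam v (Vgen lam x) by apply/in_W_submx; exists x.
    have := WS _ XW; rewrite -Wh // => /(antifixedP _ Wu)/(antifixed_coord _ Uu U2).
    by case=> y /(Vgen_inj hlam) <-.
  have : i_antisym (adjmx W *m Vgen lam x *m W).
    by apply/(antifixedP _ Wu)/(antifixed_coord _ Uu U2); exists x.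
  move=> /SW[X [XW]]; rewrite -Wh // => e.
  have /in_W_submx[y Xy yV] := XW; suff -> : x = y by [].
  apply: (Vgen_inj hlam); rewrite -Xy.
  have := congr1 (fun Z => W *m Z *m adjmx W) e.
  by rewrite !mulmxA Wu !mul1mx -!mulmxA Wu !mulmx1.
have s2 : s *m s = 1%:M by exact: cp_mxK.
have sT : s^T = s by exact: tr_cp_mx.
(* Since [s] is an involution, [1 - s] maps into its (-1)-eigenspace. A vector orthogonal to that
   space is thus fixed by [s]. *)
have sub (x : 'cV[R]_(ng N)) : ((x - s *m x)^T <= mx_of v)%MS.
  by apply/anti; rewrite mulmxBr mulmxA s2 mul1mx opprB.
have ortho (K : 'I_(ng N) -> R) :
    (forall a, \sum_i K i * v a i 0 = 0) -> \row_a K a *m s = \row_a K a.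
  move=> K0; have KV : \row_a K a *m (mx_of v)^T = 0.
    apply/rowP=> a; rewrite !mxE -[RHS](K0 a); apply: eq_bigr => i _.
    by rewrite !mxE.
  apply: mulmx_cV_ext => x; apply/esym/eqP; rewrite -subr_eq0 -mulmxA -mulmxBr.
  have /submxP[c xE] := sub x.
  by rewrite -[x - _]trmxK xE trmx_mul mulmxA KV mul0mx.
split; [by apply: ortho => a; case: (ii a) | by apply: ortho => a; case: (ii a) | ].
have VL : (mx_of v *m Lam <= mx_of v)%MS.
  apply/row_subP=> a; rewrite row_mul.
  have rE : row a (mx_of v) = (v a)^T by apply/rowP=> i; rewrite !mxE.
  have [_ [mu vmu]] := veig a.
  rewrite rE -[Lam]Ls -trmx_mul vmu linearZ /= -rE scalemx_sub //.
  exact: row_sub.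
(* A span of eigenvectors is stable under [Lam], so [Lam (x - s x)] is again negated by [s]. *)
have sL : s *m Lam *m (1%:M - s) = - (Lam *m (1%:M - s)).
  apply: mulmx_cV_ext => x; rewrite mulNmx -!mulmxA mulmxBl mul1mx.
  apply/anti; rewrite trmx_mul Ls.
  by have /submxP[c ->] := sub x; rewrite -mulmxA mulmx_sub.
(* [e1] and its transpose [e2] together force [s] and [Lam] to commute. *)
have e1 : s *m Lam - s *m Lam *m s = - Lam + Lam *m s.
  by move: sL; rewrite !mulmxBr !mulmx1 opprD opprK.
have e2 : Lam *m s - s *m Lam *m s = - Lam + s *m Lam.
  have := congr1 trmx e1.
  rewrite [LHS]linearB [RHS]linearD /= [(- Lam)^T]linearN /= !trmx_mul sT Ls.
  by rewrite mulmxA.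
have : s *m Lam - Lam *m s = Lam *m s - s *m Lam.
  transitivity ((s *m Lam - s *m Lam *m s) - (Lam *m s - s *m Lam *m s)).
    by rewrite opprB addrA subrK.
  by rewrite e1 e2 opprD opprK [- Lam + _]addrC addrA subrK.
move/eqP; rewrite -subr_eq0 opprB -[_ + (_ - _)]mulr2n -scaler_nat scaler_eq0.
by rewrite pnatr_eq0 /= subr_eq0 => /eqP.
Qed.

(** * Necessity of the two conditions *)

Lemma antisym_lam (a : 'I_(ng N)) : (a < nk N)%N -> (lam a)^T = - lam a.
Proof.
have [herm _ _ im _] := hlam => ak.
by rewrite -{1}(herm a) tr_adjmx im.
Qed.

(** A symmetric times an antisymmetric matrix has trace zero; hence only the first [nk N] generators
    occur in [Y]. *)
Lemma gcoord_antisym Y (a : 'I_(ng N)) :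
  Y^T = - Y -> (nk N <= a)%N -> gcoord lam Y a 0 = 0.
Proof.
have [herm _ _ _ re] := hlam => Ya ak; rewrite mxE.
have lamT : (lam a)^T = lam a by rewrite -{1}(herm a) tr_adjmx re.
suff -> : \tr (Y *m lam a) = 0 by rewrite mul0r.
apply/eqP; have : \tr (Y *m lam a) = - \tr (Y *m lam a).
  by rewrite -{1}mxtrace_tr trmx_mul lamT Ya mulmxN linearN /= mxtrace_mulC.
by move/eqP; rewrite -addr_eq0 -mulr2n mulrn_eq0.
Qed.

(** The basis consists of the antisymmetric generators conjugated by [W], which keeps their trace
    products. Orthonormality later makes the restriction of [Lam] a symmetric matrix. *)
Lemma antifixed_orthonormal_basis (W : 'M[C]_N) : W *m adjmx W = 1%:M ->
  exists2 B : 'M[R]_(nk N, ng N), B *m B^T = 1%:M &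
    forall x : 'cV[R]_(ng N),
      (x^T <= B)%MS <-> cp_mx lam (W *m W^T) *m x = - x.
Proof.
move=> Wu; have Wu' : adjmx W *m W = 1%:M by exact: mulmx1C.
have [Uu U2] := symmetric_unitary Wu.
have [herm tr0 orth im _] := hlam.
pose iota := widen_ord (nk_le_ng hN).
have [b bE] : exists b : 'I_(nk N) -> 'cV[R]_(ng N),
    forall a, Vgen lam (b a) = W *m lam (iota a) *m adjmx W.
  exists (fun a => gcoord lam (W *m lam (iota a) *m adjmx W)) => a.
  apply: gcoordK => //; first by rewrite !adjmxM adjmxK herm mulmxA.
  by rewrite mxtrace_mulC mulmxA Wu' mul1mx.
pose B : 'M[R]_(nk N, ng N) := \matrix_a (b a)^T.
have BE : mx_of b = B by apply/matrixP=> a i; rewrite !mxE.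
have banti a : cp_mx lam (W *m W^T) *m b a = - b a.
  have : i_antisym (adjmx W *m Vgen lam (b a) *m W).
    rewrite bE !mulmxA Wu' mul1mx -mulmxA Wu' mulmx1; apply/i_antisymP.
    by split; [exact: herm | exact: (@antisym_lam (iota a) (ltn_ord a))].
  move=> /(antifixedP _ Wu)/(antifixed_coord _ Uu U2)[x].
  by move/(Vgen_inj hlam) => ->.
exists B => [|x].
  apply/matrixP=> a a'.
  have : \tr (Vgen lam (b a) *m Vgen lam (b a')) =
         \tr (lam (iota a) *m lam (iota a')).
    rewrite !bE; move: (lam (iota a)) (lam (iota a')) => X Y.
    rewrite -mulmxA mulmxA -mulmxA [adjmx W *m (W *m Y *m _)]mulmxA.
    rewrite [adjmx W *m _]mulmxA Wu' mul1mx mulmxA mxtrace_mulC !mulmxA.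
    by rewrite Wu' mul1mx.
  rewrite (tr_VgenM hlam) orth.
  have -> : (B *m B^T) a a' = ((b a)^T *m b a') 0 0.
    by rewrite !mxE; apply: eq_bigr => i _; rewrite !mxE.
  rewrite rmorphMn /= => /(pmulrnI (ltn0Sn 1)) e.
  apply: (@rC_inj R); rewrite e mxE rmorph_nat.
  by congr (_ %:R).
split=> [/submxP[c xE]|xa].
  rewrite -[x]trmxK xE mulmx_sum_row raddf_sum mulmx_sumr -sumrN.
  apply: eq_bigr => a _ /=.
  by rewrite rowK linearZ /= trmxK -scalemxAr banti scalerN.
rewrite -BE; have : in_W lam b (Vgen lam x); last first.
  by move/in_W_submx=> [y /(Vgen_inj hlam)->].
have : i_antisym (adjmx W *m Vgen lam x *m W).
  by apply/(antifixedP _ Wu)/(antifixed_coord _ Uu U2); exists x.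
move YE: (_ *m W) => Y /i_antisymP[Yh Ya].
have -> : Vgen lam x = W *m Y *m adjmx W.
  by rewrite -YE !mulmxA Wu mul1mx -mulmxA Wu mulmx1.
exists (fun a => gcoord lam Y (iota a) 0).
rewrite -[in LHS](gcoordK hN hlam Yh (tr_antisym Ya)) /Vgen.
rewrite (bigID (fun a : 'I_(ng N) => (a < nk N)%N)) /= [X in _ + X]big1 ?addr0.
  rewrite (big_ord_narrow (nk_le_ng hN)) mulmx_sumr mulmx_suml.
  by apply: eq_bigr => a _; rewrite -scalemxAr -scalemxAl -/(iota a) -bE.
by move=> a; rewrite -leqNgt => /(gcoord_antisym Ya)->; rewrite rmorph0 scale0r.
Qed.

Lemma conditions_of_CP2 M0 Lam0 M L (Lam : 'M[R]_(ng N)) : Lam^T = Lam ->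
  has_CP2 lam M0 Lam0 M L Lam ->
  exists v, cond_i lam Lam v /\ cond_ii M L v.
Proof.
move=> Ls [U [Uu U2 /(cp_invariantP hN hlam Uu U2 _ _ _ _ Ls)]].
have [W Wu UE] := symmetric_unitary_factor Uu (cp_sym Uu U2).
have [B BB Banti] := antifixed_orthonormal_basis Wu.
move: Uu U2 Banti; rewrite -UE => Uu U2; set s := cp_mx lam U => Banti [sM sL sLam].
have sT : s^T = s by exact: tr_cp_mx.
(* [Lam] commutes with [s] and so preserves its (-1)-eigenspace; [D] is the matrix of the
   restriction in the basis [B]. *)
have /submxP[D BD] : (B *m Lam <= B)%MS.
  apply/row_subP=> a; rewrite row_mul -[Lam]Ls -[row a B]trmxK -trmx_mul.
  apply/Banti; rewrite mulmxA sLam -mulmxA -mulmxN; congr (_ *m _).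
  by apply/Banti; rewrite trmxK row_sub.
have DE : D = B *m Lam *m B^T by rewrite BD -mulmxA BB mulmx1.
have [|P [d [Pu PD]]] := @real_symmetric_diagonalization _ _ D.
  by rewrite DE !trmx_mul trmxK Ls mulmxA.
(* From [P D = diag_mx d P] follows [P B Lam = diag_mx d P B]: the rows of [P B] are eigenvectors of
   [Lam], still spanning the eigenspace of [s]. *)
pose v a : 'cV[R]_(ng N) := (row a (P *m B))^T.
have vE : mx_of v = P *m B by apply/matrixP=> a i; rewrite !mxE.
have Bfree : row_free B by apply/row_freeP; exists B^T.
have Vfree : row_free (P *m B) by rewrite /row_free mxrankMfree // mxrank_unit.
have Vanti (x : 'cV[R]_(ng N)) : (x^T <= mx_of v)%MS <-> s *m x = - x.
  rewrite -Banti vE; have /eqmxP PB : (P *m B == B)%MS.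
    by apply/eqmxP/eqmxMfull; rewrite row_full_unit.
  by rewrite PB.
have vanti a : s *m v a = - v a by apply/Vanti; rewrite trmxK vE row_sub.
have inW X : in_W lam v X <-> [/\ adjmx X = X, \tr X = 0 & cp_dual U X = - X].
  rewrite (antifixed_coord _ Uu U2) in_W_submx.
  by split=> -[x Xx xv]; exists x => //; apply/Vanti.
have inWS X : in_W lam v X <-> i_antisym (adjmx W *m X *m W).
  by rewrite inW (antifixedP _ Wu) UE.
have invW : invmx (adjmx W) = W.
  by rewrite -[RHS](mulKmx (_ : adjmx W \in unitmx)) ?(mulmx1C Wu) ?mulmx1 //;
     case/mulmx1_unit: Wu.
exists v; split; last first.
  have ortho (K : 'I_(ng N) -> R) a :
      \row_a K a *m s = \row_a K a -> \sum_i K i * v a i 0 = 0.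
    (* [K] is fixed and [v a] is negated by [s], so their product equals its own opposite. *)
    move=> Ks; have e : \row_a K a *m v a = 0.
      have : \row_a K a *m v a = - (\row_a K a *m v a).
        by rewrite -{1}Ks -mulmxA vanti mulmxN.
      move/eqP; rewrite -addr_eq0 -mulr2n -scaler_nat scaler_eq0 pnatr_eq0.
      by move/eqP.
    transitivity ((\row_a K a *m v a) 0 0); last by rewrite e mxE.
    by rewrite [RHS]mxE; apply: eq_bigr => i _; congr (_ * _); rewrite mxE.
  by move=> a; split; apply: ortho.
split.
- by rewrite -/(mx_of v) vE.
- move=> a; split.
    apply/eqP => v0; have : row a (P *m B) = 0 by rewrite -[LHS]trmxK -/(v a) v0 trmx0.
    rewrite rowE => /eqP; rewrite mulmx_free_eq0 // => /eqP/rowP/(_ a).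
    by rewrite !mxE !eqxx => /eqP; rewrite oner_eq0.
  exists (d 0 a); rewrite /v -{1}Ls -trmx_mul -linearZ /= -row_mul; congr (_ ^T).
  rewrite -mulmxA BD mulmxA PD -mulmxA row_mul row_diag_mx -scalemxAl.
  by rewrite -rowE.
- move=> X Y /inW[Xh X0 Xa] /inW[Yh Y0 Ya]; apply/inW; split.
  + rewrite /adjmx map_mxZ rmorphN /= cconjI opprK linearZ /= map_mxB linearB /=.
    rewrite !map_mxM !trmx_mul -!/(adjmx _) Xh Yh.
    by rewrite scaleNr -scalerN opprB.
  + by rewrite linearZ linearB /= mxtrace_mulC subrr mulr0.
  (* The two signs from [Xa] and [Ya] cancel; the reversed product supplies the remaining minus. *)
  + rewrite cp_dualZ cp_dualB !(cp_dualM U2) Xa Ya !mulmxN !mulNmx !opprK.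
    by rewrite -scalerN opprB.
- exists (adjmx W); rewrite invW; split.
  + by case/mulmx1_unit: Wu.
  + by move=> X /inWS.
  + move=> Y Yi; have YE : Y = adjmx W *m (W *m Y *m adjmx W) *m W.
      by rewrite !mulmxA (mulmx1C Wu) mul1mx -mulmxA (mulmx1C Wu) mulmx1.
    by exists (W *m Y *m adjmx W); split=> //; apply/inWS; rewrite -YE.
Qed.

End Main.

Theorem theorem1 (R : realType) (N : nat) (hN : (2 <= N)%N)
    (lam : 'I_(ng N) -> 'M[R[i]]_N) (hlam : gell_mann_basis lam)
    (M0 Lam0 : R) (M L : 'I_(ng N) -> R) (Lam : 'M[R]_(ng N))
    (hLam : Lam^T = Lam) :
  has_CP2 lam M0 Lam0 M L Lam <->
  exists v : 'I_(nk N) -> 'cV[R]_(ng N), cond_i lam Lam v /\ cond_ii M L v.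
Proof.
split=> [|[v [ci cii]]]; first exact: conditions_of_CP2.
exact: (CP2_of_conditions hN hlam _ _ hLam ci cii).
Qed.
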